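(* Let $\mu:\mathbb{R}\to\mathbb{R}$ be an activation function such that for each positive integer $k$ the coordinatewise map $\mu:\mathbb{R}^k\to\mathbb{R}^k$ is group homotopic to a homeomorphism $F:\mathbb{R}^k\to F(\mathbb{R}^k)\subset\mathbb{R}^k$ (where $F$ may depend on $k$). Let $n>m\ge 1$ and let $A,B\subset\mathbb{R}^n$ be disjoint compact sets which are a link pair with nonzero degree. Then every deep neural network $Net^{\mu}:\mathbb{R}^n\to\mathbb{R}^m$ with activation $\mu$ and width not greater than $n$ fails to classify $A$ and $B$, i.e. $Net^{\mu}(A)\cap Net^{\mu}(B)\neq\emptyset$.
   Context: Activation: for a continuous scalar function $\mu:\mathbb{R}\to\mathbb{R}$, the map $\mu:\mathbb{R}^k\to\mathbb{R}^k$ is $\mu(x_1,\dots,x_k)=(\mu(x_1),\dots,\mu(x_k))$. Group homotopy: for a topological space $X$ and maps $P,Q:X\to X$, $P$ is group homotopic to $Q$ if there is a continuous $H:X\times[0,1]\to X$ with $H(x,0)=Q(x)$, $H(x,1)=P(x)$ for all $x\in X$, and $H(x,t_1+t_2)=H(H(x,t_1),t_2)$ for all $x\in X$ and all $t_1,t_2\in[0,1]$ with $t_1+t_2\in[0,1]$. Here $Q$ is the homeomorphism $F$ onto its image, regarded as a map $\mathbb{R}^k\to\mathbb{R}^k$. Deep neural network: with $n>m$, a map $Net^\mu:\mathbb{R}^n\to\mathbb{R}^m$ of the form $Net^\mu=\mu\circ A_k\circ\mu\circ A_{k-1}\circ\cdots\circ\mu\circ A_1$, where $k\ge1$, $n_1=n$,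 $n_{k+1}=m$, the $n_i$ are positive integers, and each $A_i:\mathbb{R}^{n_i}\to\mathbb{R}^{n_{i+1}}$ is affine, $A_i(x)=W_ix+b_i$. Its depth is $k$ and its width is $\max\{n_i: i=1,\dots,k\}$. Classify: a continuous map $G:\mathbb{R}^n\to\mathbb{R}^m$ classifies compact sets $B_1,\dots,B_r\subset\mathbb{R}^n$ if $G(B_i)\cap G(B_j)=\emptyset$ for all $i\ne j$. Link pair with nonzero degree: disjoint compact connected sets $A,B\subset\mathbb{R}^n$ are a link pair with nonzero degree if the map $\xi:A\times B\to S^{n-1}$, $\xi(x,y)=\frac{x-y}{\|x-y\|}$, has nonzero degree. For the degree to make sense, $A$ and $B$ are closed (compact, without boundary) connected oriented topological manifolds, embedded in $\mathbb{R}^n$, with $\dim A+\dim B=n-1$. *)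

(* Defs.v *)
From HB Require Import structures.
From mathcomp Require Import all_boot all_order all_algebra.
From mathcomp Require Import all_classical all_reals topology normedtype realfun.
From mathcomp.multinomials Require Import freeg.

Set Implicit Arguments.
Unset Strict Implicit.
Unset Printing Implicit Defensive.

Import Order.TTheory GRing.Theory Num.Theory.
Import numFieldNormedType.Exports.

Local Open Scope classical_set_scope.
Local Open Scope ring_scope.

(** The Euclidean space R^n is ['rV[R]_n], so an affine map is written
    [x *m W + b] ([W] is the transpose of the matrix acting on columns). *)

(** * Networks *)

Inductive network (R : realType) : nat -> nat -> Type :=
| last_layer n m (W : 'M[R]_(n, m)) (b : 'rV[R]_m) : network R n m
| add_layer n p m (p_gt0 : (0 < p)%N) (W : 'M[R]_(n, p)) (b : 'rV[R]_p)
    (N : network R p m) : network R n m.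

Fixpoint net (R : realType) (mu : R -> R) (n m : nat) (N : network R n m) :
    'rV[R]_n -> 'rV[R]_m :=
  match N in network _ n m return 'rV[R]_n -> 'rV[R]_m with
  | last_layer _ _ W b => fun x => map_mx mu (x *m W + b)
  | add_layer _ _ _ _ W b N => fun x => net mu N (map_mx mu (x *m W + b))
  end.

(** The output dimension does not count towards the width. *)
Fixpoint width (R : realType) (n m : nat) (N : network R n m) : nat :=
  match N with
  | last_layer n _ _ _ => n
  | add_layer n _ _ _ _ _ N => maxn n (width N)
  end.

(** * Group homotopy *)

(** [P] is the time 1 map and [Q] the time 0 map. *)
Definition group_homotopic (R : realType) (X : topologicalType) (P Q : X -> X) :=
  exists H : X * R -> X,
    [/\ {within [set: X] `*` `[0, 1]%classic, continuous H},
        forall x, H (x, 0) = Q x,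
        forall x, H (x, 1) = P x
      & forall x t1 t2, t1 \in `[0, 1] -> t2 \in `[0, 1] ->
          t1 + t2 \in `[0, 1] -> H (x, t1 + t2) = H (H (x, t1), t2)].

Definition topological_embedding (X Y : topologicalType) (F : X -> Y) :=
  continuous F /\
  exists G : Y -> X, {within range F, continuous G} /\ cancel F G.

(** * Singular homology with integer coefficients *)

Section simplex.
Variable R : realType.

Definition std_simplex k : set 'rV[R]_k.+1 :=
  [set x | (forall i, 0 <= x ord0 i) /\ \sum_i x ord0 i = 1].
Arguments std_simplex : clear implicits.

Definition insert0 k (i : 'I_k.+2) (x : 'rV[R]_k.+1) : 'rV[R]_k.+2 :=
  \row_j oapp (x ord0) 0 (unlift i j).

Lemma insert0_simplex k i (x : set_type (std_simplex k)) :
  insert0 i (val x) \in std_simplex k.+1.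
Proof.
have /set_mem [x0 x1] := valP x; apply/mem_set; split => [j|].
  by rewrite mxE; case: unliftP => [j' _|_] //=.
rewrite (bigD1_ord i) //= mxE unlift_none /= add0r -x1.
by apply: eq_bigr => j _; rewrite mxE liftK.
Qed.

Definition face k (i : 'I_k.+2) (x : set_type (std_simplex k)) :
  set_type (std_simplex k.+1) := exist (fun y => y \in std_simplex k.+1) _ (insert0_simplex i x).

Lemma row_continuous (X : topologicalType) n (f : X -> 'rV[R]_n) :
  (forall j, continuous (fun x => f x ord0 j)) -> continuous f.
Proof.
move=> cf x A [P nP PA].
have : \forall y \near x, forall ij : 'I_1 * 'I_n, P ij.1 ij.2 (f y ij.1 ij.2).
  apply: filter_forall => -[i j] /=; rewrite [i]ord1.
  by apply: cf; rewrite -[X in P X](ord1 ord0); exact: nP.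
by apply: filterS => y Py; apply: PA => i j; exact: (Py (i, j)).
Qed.

Lemma face_continuous k (i : 'I_k.+2) : continuous (@face k i).
Proof.
apply: continuous_comp_initial; apply: row_continuous => j.
rewrite /face /=; case: (unliftP i j) => [j' ->|->]; last first.
  rewrite (_ : (fun _ => _) = fun=> 0); first exact: cst_continuous.
  by apply/funext => x; rewrite set_valE mxE unlift_none.
rewrite (_ : (fun _ => _) = (fun y : 'rV_k.+1 => y ord0 j') \o set_val).
  move=> x; apply: continuous_comp; first exact: initial_continuous.
  exact: coord_continuous.
by apply/funext => x; rewrite !set_valE mxE liftK.
Qed.

HB.instance Definition _ k (i : 'I_k.+2) :=
  isContinuous.Build _ _ (@face k i) (@face_continuous k i).

End simplex.
Arguments std_simplex : clear implicits.

Definition sing_simplex (R : realType) (X : topologicalType) k :=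
  continuousType (set_type (std_simplex R k)) X.

Definition chain (R : realType) (X : topologicalType) k : lmodType int :=
  {freeg (sing_simplex R X k) / int}.

Section homology.
Variables (R : realType) (X : topologicalType).

Definition boundary k (c : chain R X k.+1) : chain R X k :=
  fglift (fun s : sing_simplex R X k.+1 =>
    \sum_(i < k.+2) (-1) ^+ i *:
      (<< (s \o @face R k i : sing_simplex R X k) >> : chain R X k)) c.

(** [c] is a chain of the subspace [V] of [X]. *)
Definition chain_in (V : set X) k (c : chain R X k) : Prop :=
  forall s : sing_simplex R X k, coeff s c != 0 -> range s `<=` V.

(** Cycles and homologous cycles of the pair [(X, V)]: [H_k(X, V)] is the
    quotient of the former by the latter, and [H_k(X)] is the case
    [V = set0]. *)
Definition rel_cycle (V : set X) k : chain R X k -> Prop :=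
  match k with
  | 0 => fun=> True
  | k'.+1 => fun c => chain_in V (boundary c)
  end.

Definition rel_homologous (V : set X) k (c c' : chain R X k) : Prop :=
  exists e : chain R X k.+1, chain_in V (c - c' - boundary e).

(** The class of [c] freely generates the infinite cyclic group
    [H_k(X, X \ x)]. *)
Definition local_generator k (x : X) (c : chain R X k) : Prop :=
  rel_cycle [set~ x] c /\
  forall z : chain R X k, rel_cycle [set~ x] z ->
    exists! d : int, rel_homologous [set~ x] z (d *: c).

(** A locally consistent choice of a generator of [H_k(X, X \ x)], given by
    representing relative cycles. *)
Definition orientation k (o : X -> chain R X k) : Prop :=
  (forall x, local_generator x (o x)) /\
  forall x, exists (U : set X) (b : chain R X k),
    [/\ open_nbhs x U, rel_cycle (~` U) b
      & forall y, U y -> rel_homologous [set~ y] b (o y)].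

Definition fundamental_class k (o : X -> chain R X k) (c : chain R X k) : Prop :=
  rel_cycle set0 c /\ forall x, rel_homologous [set~ x] c (o x).

End homology.

Definition pushforward (R : realType) (X Y : topologicalType)
    (f : continuousType X Y) k (c : chain R X k) : chain R Y k :=
  fglift (fun s : sing_simplex R X k =>
    (<< (f \o s : sing_simplex R Y k) >> : chain R Y k)) c.

(** [f_*[X] = d [Y]] in [H_k(Y)], for closed manifolds [X] and [Y] of
    dimension [k] oriented by [oX] and [oY]. *)
Definition has_degree (R : realType) (X Y : topologicalType) k
    (oX : X -> chain R X k) (oY : Y -> chain R Y k)
    (f : continuousType X Y) (d : int) : Prop :=
  exists (cX : chain R X k) (cY : chain R Y k),
    [/\ fundamental_class oX cX, fundamental_class oY cY
      & rel_homologous set0 (pushforward f cX) (d *: cY)].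

(** * Link pairs *)

Definition topological_manifold (R : realType) p (X : topologicalType) : Prop :=
  [/\ hausdorff_space X, @second_countable X
    & forall x : X, exists (U : set X) (f : X -> 'rV[R]_p) (g : 'rV[R]_p -> X),
        [/\ open_nbhs x U, {within U, continuous f}, continuous g,
            range g `<=` U & {in U, cancel f g} /\ cancel g f]].

Section link.
Variables (R : realType) (n : nat).

Definition enorm (x : 'rV[R]_n) : R := Num.sqrt (\sum_i x ord0 i ^+ 2).

Definition sphere : set 'rV[R]_n := [set x | enorm x = 1].

Lemma enorm_eq0 x : enorm x = 0 -> x = 0.
Proof.
move=> /eqP; rewrite sqrtr_eq0 => le0; apply/rowP => i; rewrite mxE.
have s0 : \sum_i x ord0 i ^+ 2 = 0.
  by apply/le_anti; rewrite le0 sumr_ge0 // => j _; exact: sqr_ge0.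
have /eqP := s0; rewrite psumr_eq0 => [/allP/(_ i)|j _]; last exact: sqr_ge0.
by rewrite mem_index_enum sqrf_eq0 => /(_ isT)/eqP.
Qed.

Lemma enorm_neq0 x : x != 0 -> enorm x != 0.
Proof. by apply: contra_neq; exact: enorm_eq0. Qed.

Lemma enorm_continuous : continuous enorm.
Proof.
move=> x; rewrite /enorm.
apply: (@continuous_comp _ _ _ (fun x : 'rV[R]_n => \sum_i x ord0 i ^+ 2)).
  apply: (@cvg_big R _ +%R 0 xpredT _ _ (nbhs x)) => [|i _]; first exact: add_continuous.
  by apply: (@continuous_comp _ _ _ (fun y : 'rV[R]_n => y ord0 i) (fun t => t ^+ 2));
    [exact: coord_continuous|exact: exprn_continuous].
exact: sqrt_continuous.
Qed.

Variables (A B : set 'rV[R]_n) (AB0 : A `&` B = set0).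

Lemma link_neq0 (xy : set_type A * set_type B) : val xy.1 - val xy.2 != 0.
Proof.
rewrite subr_eq0; apply/eqP => xy_eq.
have : (A `&` B) (val xy.1).
  by split; [exact: set_mem (valP xy.1)|rewrite xy_eq; exact: set_mem (valP xy.2)].
by rewrite AB0.
Qed.

Lemma link_sphere (xy : set_type A * set_type B) :
  (enorm (val xy.1 - val xy.2))^-1 *: (val xy.1 - val xy.2) \in sphere.
Proof.
apply/mem_set; rewrite /sphere /=.
set v := val xy.1 - val xy.2.
have v0 : enorm v != 0 by apply: enorm_neq0; exact: link_neq0.
rewrite {1}/enorm (eq_bigr (fun i => (enorm v)^-1 ^+ 2 * v ord0 i ^+ 2)); last first.
  by move=> i _; rewrite mxE exprMn.
rewrite -mulr_sumr sqrtrM ?sqr_ge0// sqrtr_sqr -/(enorm v) ger0_norm ?mulVf//.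
by rewrite invr_ge0 sqrtr_ge0.
Qed.

Definition link_map (xy : set_type A * set_type B) : set_type sphere :=
  exist (fun z => z \in sphere) _ (link_sphere xy).

Lemma link_map_continuous : continuous link_map.
Proof.
apply: continuous_comp_initial => xy.
have cv : {for xy, continuous (fun z : set_type A * set_type B =>
    val z.1 - val z.2)}.
  apply: cvgB; apply: continuous_comp; first exact: cvg_fst.
  - exact: initial_continuous.
  - exact: cvg_snd.
  - exact: initial_continuous.
apply: cvgZ => //; apply: cvgV; first exact/enorm_neq0/link_neq0.
apply: continuous_comp => //; exact: enorm_continuous.
Qed.

HB.instance Definition _ :=
  isContinuous.Build _ _ link_map link_map_continuous.

End link.
Arguments sphere : clear implicits.

(** Only the vanishing of the degree matters, and [A * B] is connected, so its
    two orientations (opposite to each other) are interchangeable and the one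
    used need not be the product of those of [A] and [B]. *)
Definition link_pair_nonzero_degree (R : realType) (n : nat)
    (A B : set 'rV[R]_n) (AB0 : A `&` B = set0) : Prop :=
  [/\ compact A, compact B, connected A & connected B] /\
  exists p q : nat,
    [/\ (p + q).+1 = n,
        topological_manifold R p (set_type A),
        topological_manifold R q (set_type B),
        (exists oA : set_type A -> chain R (set_type A) p, orientation oA)
        /\ (exists oB : set_type B -> chain R (set_type B) q, orientation oB)
      & exists
          (oAB : set_type A * set_type B ->
             chain R (set_type A * set_type B)%type (p + q))
          (oS : set_type (sphere R n) -> chain R (set_type (sphere R n)) (p + q))
          (d : int),
          [/\ orientation oAB, orientation oS, d != 0
            & has_degree oAB oS (link_map AB0) d]].

(* Main.v *)
From HB Require Import structures.
Require Import Defs.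
From mathcomp.multinomials Require Import freeg.
From mathcomp Require Import all_boot all_order all_algebra.
From mathcomp Require Import all_classical all_reals topology normedtype realfun.
From mathcomp Require Import lra.
Import Order.TTheory GRing.Theory Num.Theory numFieldNormedType.Exports.
Local Open Scope classical_set_scope.
Local Open Scope ring_scope.

Set Implicit Arguments.
Unset Strict Implicit.
Unset Printing Implicit Defensive.

(** The theorem holds because the degree enters only through the homotopy class
    of the difference map [(a, b) |-> a - b] from [A * B] to [R^n \ 0], and a
    network that separates [A] from [B] would contract this map to a constant.

    More generally, take continuous [g, h : X -> R^n] such that the network
    never sends [g x] and [h x] to the same point; then [g - h] is
    null-homotopic in [R^n \ 0] ([null_homotopic_of_net], by induction on the
    layers).  An injective affine layer with linear part [W] acts on [g - h] as
    the invertible map [W], which can be undone.  If [W] kills some [v <> 0] but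
    [(g x - h x) W] never vanishes, then no multiple of [v] is a value of
    [g - h], and the segments from [g x - h x] to [v] avoid [0]
    ([null_homotopic_of_kernel]); as the widths are at most [n] and the output
    dimension is smaller than [n], such a layer occurs at the latest where the
    dimension first drops.  For the activation, the time 0 map [Q] of a group
    homotopy satisfies [Q o Q = Q], so being injective it is the identity.  The
    homotopy is thus a semiflow from the identity to [mu], and two points that
    meet at some time stay together up to time 1: if [mu] separates [g x] from
    [h x], so does every intermediate time, and the difference of the two
    trajectories is a homotopy in [R^n \ 0] from [g - h] to [mu g - mu h]
    ([null_homotopic_of_group_homotopic]).

    It remains to see that a null-homotopic map [f : X -> Y] has degree [0] in
    positive dimension ([degree_null_homotopic]).  A contraction of [f] extends
    [f s], for every singular simplex [s], to the cone over the simplex.  This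
    gives an operator [C] on chains with [boundary (C c) = f_* c - C (boundary c)]
    ([boundary_cone_chain]), so [f_*] of a fundamental cycle of [X] is a
    boundary.  If it is also homologous to [d] times a fundamental cycle of [Y],
    then [d] times a generator of the local homology at a point of [Y]
    vanishes, and [d = 0]. *)

(** * Null-homotopic maps *)

Section homotopy.
Variable R : realType.
Implicit Types (X : topologicalType) (n : nat) (t : R).

Definition clamp t : R := Num.max 0 (Num.min 1 t).

Lemma clamp_continuous : continuous clamp.
Proof.
move=> t; apply: (@continuous_max R R (fun=> 0) (Num.min 1)); first exact: cvg_cst.
by apply: (@continuous_min R R (fun=> 1) id) => //; exact: cvg_cst.
Qed.

Lemma clamp_itv t : clamp t \in `[0, 1].
Proof. by rewrite /clamp in_itv /= le_max lexx /= ge_max ler01 ge_min lexx. Qed.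

Lemma clamp_le0 t : t <= 0 -> clamp t = 0.
Proof.
move=> t0; rewrite /clamp min_r; first by apply/max_idPl.
by apply: le_trans t0 _.
Qed.

Lemma clamp_ge1 t : 1 <= t -> clamp t = 1.
Proof. by move=> t1; rewrite /clamp min_l // max_r. Qed.

Lemma clamp_id t : t \in `[0, 1] -> clamp t = t.
Proof.
by rewrite in_itv /= => /andP[t0 t1]; rewrite /clamp min_r // max_r.
Qed.

Definition punctured n : set 'rV[R]_n := [set v | v != 0].

(** The homotopy is defined for all real times, so that it is continuous on a
    plain product; being constant from time 1 on, it can be reparametrized so as
    to be constant near the end of the unit interval. *)
Definition null_homotopic_in {X Y : topologicalType} (V : set Y) (f : X -> Y) :=
  exists (H : X * R -> Y) (y : Y),
    [/\ continuous H, forall z, V (H z), V y, forall x, H (x, 0) = f x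
      & forall x t, 1 <= t -> H (x, t) = y].

Lemma continuous_pair {X Y Z : topologicalType} (f : X -> Y) (g : X -> Z) :
  continuous f -> continuous g -> continuous (fun x => (f x, g x)).
Proof. by move=> cf cg x; apply: cvg_pair; [exact: cf|exact: cg]. Qed.

Lemma continuous_compose {X Y Z : topologicalType} (f : X -> Y) (g : Y -> Z) :
  continuous f -> continuous g -> continuous (fun x => g (f x)).
Proof. by move=> cf cg x; apply: continuous_comp; [exact: cf|exact: cg]. Qed.

Lemma reparam_continuous {X Y : topologicalType} (u : R -> R) (H : X * R -> Y) :
  continuous u -> continuous H -> continuous (fun z : X * R => H (z.1, u z.2)).
Proof.
move=> cu cH; apply: continuous_compose (cH).
apply: continuous_pair => [z|]; first exact: cvg_fst.
by apply: continuous_compose cu => z; exact: cvg_snd.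
Qed.

Lemma affine_time_continuous (a b : R) : continuous (fun t => a * t + b).
Proof.
by move=> t; apply: cvgD; [apply: cvgM; [exact: cvg_cst|exact: cvg_id]|exact: cvg_cst].
Qed.

(** Concatenation of homotopies.  Since the target is a vector space, the two
    halves are glued by adding them and subtracting the common value at the
    junction: at each time one of them is stationary and cancels it.  This is
    continuous without any pasting argument. *)
Lemma null_homotopic_from X n (H : X * R -> 'rV[R]_n) :
  continuous H ->
  (forall x t, t \in `[0, 1] -> H (x, t) != 0) ->
  null_homotopic_in (@punctured n) (fun x => H (x, 1)) ->
  null_homotopic_in (@punctured n) (fun x => H (x, 0)).
Proof.
move=> cH H_neq0 [K [y [cK K_neq0 y_neq0 K0 K1]]].
exists (fun z => H (z.1, clamp (2 * z.2 + 0)) + K (z.1, clamp (2 * z.2 - 1))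
                 - K (z.1, 0)), y; split => // [|[x t]|x|x t t1] /=.
- have cu b : continuous (fun t => clamp (2 * t + b)).
    by apply: continuous_compose clamp_continuous; exact: affine_time_continuous.
  have c0 : continuous (fun _ : R => 0 : R) by move=> ?; exact: cvg_cst.
  move=> z; apply: cvgB; first apply: cvgD.
  + exact: (reparam_continuous (cu 0)).
  + exact: (reparam_continuous (cu (-1))).
  + exact: (reparam_continuous c0).
- rewrite K0 addr0; have [t_le|t_gt] := leP (2 * t) 1.
    rewrite (@clamp_le0 (2 * t - 1)) ?subr_le0 // K0 addrK.
    exact/H_neq0/clamp_itv.
  by rewrite (@clamp_ge1 (2 * t)) ?ltW // addrAC subrr add0r; exact: K_neq0.
- by rewrite mulr0 addr0 !clamp_le0 ?addrK // sub0r lerN10.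
- have t1' : 1 <= 2 * t + 0 by lra.
  have t1'' : 1 <= 2 * t - 1 by lra.
  rewrite (clamp_ge1 t1') (clamp_ge1 t1'').
  by rewrite K0 K1 // addrAC subrr add0r.
Qed.

Lemma null_homotopic_cst {X Y : topologicalType} (V : set Y) (y : Y) :
  V y -> null_homotopic_in V (fun _ : X => y).
Proof. by move=> Vy; exists (fun=> y), y; split=> // z; exact: cvg_cst. Qed.

Lemma null_homotopic_comp {X Y Z : topologicalType} (V : set Y) (W : set Z)
    (f : X -> Y) (g : Y -> Z) :
  continuous g -> (forall y, V y -> W (g y)) ->
  null_homotopic_in V f -> null_homotopic_in W (fun x => g (f x)).
Proof.
move=> cg VW [H [y [cH VH Vy H0 H1]]]; exists (fun z => g (H z)), (g y); split.
- exact: continuous_compose.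
- by move=> z; exact: VW.
- exact: VW.
- by move=> x; rewrite H0.
- by move=> x t /H1 ->.
Qed.

Lemma mulmx_continuous n m (W : 'M[R]_(n, m)) :
  continuous (fun x : 'rV[R]_n => x *m W).
Proof.
apply: row_continuous => j.
under eq_fun do rewrite mxE.
move=> x; apply: (@cvg_big R _ +%R 0 xpredT _ _ (nbhs x)) => [|i _].
  exact: add_continuous.
by apply: cvgM; [exact: coord_continuous|exact: cvg_cst].
Qed.

Lemma map_mx_continuous n (mu : R -> R) :
  continuous mu -> continuous (map_mx mu : 'rV[R]_n -> 'rV[R]_n).
Proof.
move=> cmu; apply: row_continuous => j; under eq_fun do rewrite mxE.
by apply: continuous_compose cmu; exact: coord_continuous.
Qed.

(** * Layers of a network *)

(** For [v] in the kernel of [W], the segment from [d x] to [v] misses [0]: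
    applying [W] to a zero of it forces the endpoint [v], which is not [0]. *)
Lemma null_homotopic_of_kernel X n p (W : 'M[R]_(n, p)) (d : X -> 'rV[R]_n) :
  continuous d -> ~~ row_free W -> (forall x, d x *m W != 0) ->
  null_homotopic_in (@punctured n) d.
Proof.
move=> cd; rewrite -kermx_eq0 => /rowV0Pn[v /sub_kermxP vW v0] dW.
pose H (z : X * R) := (1 - z.2) *: d z.1 + z.2 *: v.
have H0 : (fun x => H (x, 0)) = d.
  by apply/funext => x; rewrite /H /= subr0 scale1r scale0r addr0.
rewrite -H0; apply: null_homotopic_from => [z|x t _|].
- apply: cvgD; apply: cvgZ.
  + by apply: cvgB; [exact: cvg_cst|exact: cvg_snd].
  + by apply: continuous_comp (cd _); exact: cvg_fst.
  + exact: cvg_snd.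
  + exact: cvg_cst.
- apply/eqP => Ht; have : H (x, t) *m W = 0 by rewrite Ht mul0mx.
  rewrite /H /= mulmxDl -!scalemxAl vW scaler0 addr0 => /eqP.
  rewrite scaler_eq0 (negbTE (dW x)) orbF subr_eq0 => /eqP t1.
  by move: Ht; rewrite /H /= -t1 subrr scale0r scale1r add0r => /eqP; apply/negP.
- under eq_fun do rewrite /H /= subrr scale0r scale1r add0r.
  exact: null_homotopic_cst.
Qed.

(** [F] is idempotent, hence the identity, and [Phi] is a semiflow: if [Phi _ t]
    merged [g x] and [h x], flowing for the remaining time [1 - t] would give
    [P (g x) = P (h x)]. *)
Lemma null_homotopic_of_group_homotopic X n (P F : 'rV[R]_n -> 'rV[R]_n)
    (g h : X -> 'rV[R]_n) :
  topological_embedding F -> group_homotopic R P F ->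
  continuous g -> continuous h -> (forall x, P (g x) != P (h x)) ->
  null_homotopic_in (@punctured n) (fun x => P (g x) - P (h x)) ->
  null_homotopic_in (@punctured n) (fun x => g x - h x).
Proof.
move=> [_ [G [_ FK]]] [Phi [cPhi Phi0 Phi1 PhiD]] cg ch neqP.
have in0 : (0 : R) \in `[0, 1] by rewrite in_itv /= lexx ler01.
have in1 : (1 : R) \in `[0, 1] by rewrite in_itv /= lexx ler01.
have F_id x : F x = x.
  apply: (can_inj FK); have := PhiD x 0 0 in0 in0.
  by rewrite addr0 => /(_ in0); rewrite !Phi0 => <-.
pose H (z : X * R) := Phi (g z.1, clamp z.2) - Phi (h z.1, clamp z.2).
(* [Phi] is continuous on the closed time strip only; clamping the time makes
   the composite continuous everywhere. *)
have cH u : continuous u -> continuous (fun z : X * R => Phi (u z.1, clamp z.2)).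
  move=> cu z A nA.
  have /subspace_continuousP/(_ (u z.1, clamp z.2)) := cPhi.
  have dom (w : X * R) : ([set: 'rV[R]_n] `*` `[0, 1]%classic) (u w.1, clamp w.2).
    by split => //=; exact: clamp_itv.
  move=> /(_ (dom z) A nA); rewrite /= /within /nbhs /= => nA'.
  have ct : continuous (fun w : X * R => (u w.1, clamp w.2)).
    apply: continuous_pair.
      by apply: continuous_compose cu => w; exact: cvg_fst.
    by apply: continuous_compose clamp_continuous => w; exact: cvg_snd.
  have := ct z _ nA'; rewrite /nbhs /=; apply: filterS => w /=; apply.
  exact: dom.
have H0 : (fun x => H (x, 0)) = (fun x => g x - h x).
  by apply/funext => x; rewrite /H /= clamp_le0 // !Phi0 !F_id.
have H1 : (fun x => H (x, 1)) = (fun x => P (g x) - P (h x)).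
  by apply/funext => x; rewrite /H /= clamp_ge1 // !Phi1.
rewrite -H0 -H1; apply: null_homotopic_from => [z|x t t01].
  by apply: cvgB; exact: cH.
have t01' : 1 - t \in `[0, 1].
  by move: t01; rewrite !in_itv /= => /andP[? ?]; apply/andP; split; lra.
have Phi_flow v : P v = Phi (Phi (v, t), 1 - t).
  by rewrite -PhiD // addrC subrK.
rewrite /H /= clamp_id // subr_eq0; apply/eqP => eqPhi.
by move/eqP: (neqP x); apply; rewrite !Phi_flow eqPhi.
Qed.

Lemma width_ge n m (N : network R n m) : (n <= width N)%N.
Proof. by case: N => //= *; exact: leq_maxl. Qed.

(** A layer with a singular linear part settles the matter at once; a layer with
    an invertible one reduces it to the rest of the network.  The width bound
    leaves no third case: a layer that raises the dimension above [n] would be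
    injective without being invertible. *)
Lemma null_homotopic_of_net (mu : R -> R) (mu_cont : continuous mu)
    (mu_homotopic : forall k : nat, (0 < k)%N ->
       exists F : 'rV[R]_k -> 'rV[R]_k,
         topological_embedding F /\
         group_homotopic R (map_mx mu : 'rV[R]_k -> 'rV[R]_k) F)
    X n m (N : network R n m) (g h : X -> 'rV[R]_n) :
  (m < n)%N -> (width N <= n)%N -> continuous g -> continuous h ->
  (forall x, net mu N (g x) != net mu N (h x)) ->
  null_homotopic_in (@punctured n) (fun x => g x - h x).
Proof.
have affineB k p (W : 'M[R]_(k, p)) b (u v : 'rV[R]_k) :
    u *m W + b - (v *m W + b) = (u - v) *m W.
  by rewrite mulmxBl opprD addrACA subrr addr0.
have kernel k p q (W : 'M[R]_(k, p)) b (f : 'rV[R]_p -> 'rV[R]_q)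
      (g' h' : X -> 'rV[R]_k) :
    ~~ row_free W -> continuous g' -> continuous h' ->
    (forall x : X, f (g' x *m W + b) != f (h' x *m W + b)) ->
    null_homotopic_in (@punctured k) (fun x => g' x - h' x).
  move=> W_sing cg ch neq; apply: (null_homotopic_of_kernel _ W_sing).
    by move=> x; apply: cvgB; [exact: cg|exact: ch].
  move=> x; rewrite -(affineB _ _ _ b) subr_eq0.
  by apply: contra_neq (neq x) => ->.
have row_free_lt k p (W : 'M[R]_(k, p)) : (p < k)%N -> ~~ row_free W.
  move=> pk; apply: contraL pk; rewrite -leqNgt => /eqP <-.
  exact: rank_leq_col.
elim: N g h => [{}n {}m W b|{}n p {}m p_gt0 W b N IHN] g h mn /=.
  by move=> _ cg ch; apply: (kernel _ _ _ W b (map_mx mu)) => //; exact: row_free_lt.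
rewrite geq_max leqnn /= => wN cg ch neq.
have [pn|np] := boolP (p < n)%N.
  apply: (kernel _ _ _ W b (fun y => net mu N (map_mx mu y))) => //.
  exact: row_free_lt.
have {np} pn : p = n.
  by apply/eqP; rewrite eqn_leq (leq_trans (width_ge N)) //= leqNgt.
subst p; have [W_free|W_sing] := boolP (row_free W); last first.
  exact: (kernel _ _ _ W b (fun y => net mu N (map_mx mu y))).
have W_unit : W \in unitmx by rewrite -row_free_unit.
have [F [F_emb F_htp]] := mu_homotopic n p_gt0.
have ca (u : X -> 'rV[R]_n) : continuous u -> continuous (fun x => u x *m W + b).
  move=> cu x; apply: cvgD; last exact: cvg_cst.
  exact: (continuous_compose cu (mulmx_continuous (W := W))).
have cmua (u : X -> 'rV[R]_n) : continuous u ->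
    continuous (fun x => map_mx mu (u x *m W + b)).
  by move=> cu; apply: continuous_compose (ca _ cu) _; exact: map_mx_continuous.
have neq_mu x : map_mx mu (g x *m W + b) != map_mx mu (h x *m W + b).
  by apply: contra_neq (neq x) => ->.
have := IHN _ _ mn wN (cmua _ cg) (cmua _ ch) neq.
move=> /(null_homotopic_of_group_homotopic F_emb F_htp (ca _ cg) (ca _ ch) neq_mu).
under eq_fun do rewrite affineB.
move=> /(null_homotopic_comp (W := @punctured n) (mulmx_continuous (W := invmx W))).
under eq_fun do rewrite mulmxK //.
apply=> y; apply: contra_neq => yW.
by rewrite -[y](mulmxKV W_unit) yW mul0mx.
Qed.

End homotopy.

(** * The cone operator on singular chains *)

Section chain_algebra.
Variables (R : realType) (X Y : topologicalType).

HB.instance Definition _ k := GRing.isZmodMorphism.Build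
  (chain R X k.+1) (chain R X k) (@boundary R X k) (lift_is_additive _).

HB.instance Definition _ (f : continuousType X Y) k := GRing.isZmodMorphism.Build
  (chain R X k) (chain R Y k) (@pushforward R X Y f k) (lift_is_additive _).

Lemma chain_additive_ext k (M : zmodType) (phi psi : {additive chain R X k -> M}) :
  (forall s : sing_simplex R X k, phi << s >> = psi << s >>) -> phi =1 psi.
Proof.
move=> eq_gen c; rewrite -[c]freeg_sumE !raddf_sum; apply: eq_bigr => s _.
by rewrite -[coeff s c]intz -freegU_mulz !raddfMz eq_gen.
Qed.
End chain_algebra.

Section cone.
Variable R : realType.

(** This is [1 - u_0] on the half of the simplex where [u_0 <= 1/2], and is kept
    away from [0] near the apex. *)
Definition cone_denom k (u : 'rV[R]_k.+1) : R :=
  Num.max 2^-1 (1 - u ord0 ord0).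

(** The radial projection of a simplex from its vertex 0 to the opposite face.
    The second summand vanishes for [u_0 <= 1/2], where this is the usual
    formula [u_j / (1 - u_0)]; near the apex it returns the missing mass to
    coordinate 0, so that the map stays continuous with values in the simplex.
    A homotopy that is constant by then sees the usual formula only. *)
Definition cone_base_row k (u : 'rV[R]_k.+2) : 'rV[R]_k.+1 :=
  \row_j (u ord0 (lift ord0 j) / cone_denom u
          + (j == ord0)%:R * (1 - (1 - u ord0 ord0) / cone_denom u)).

Lemma cone_denom_gt0 k (u : 'rV[R]_k.+1) : 0 < cone_denom u.
Proof. by rewrite lt_max invr_gt0 ltr0n. Qed.

Lemma simplex_tail k (u : 'rV[R]_k.+2) : std_simplex R _ u ->
  \sum_j u ord0 (lift ord0 j) = 1 - u ord0 ord0.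
Proof. by move=> [_]; rewrite big_ord_recl => <-; rewrite addrAC subrr add0r. Qed.

Lemma cone_base_simplex k (u : set_type (std_simplex R k.+1)) :
  cone_base_row (val u) \in std_simplex R k.
Proof.
have /set_mem u_simplex := valP u; have [u_ge0 _] := u_simplex.
apply/mem_set; split => [j|].
  rewrite mxE addr_ge0 ?mulr_ge0 ?invr_ge0 ?ler0n ?(ltW (cone_denom_gt0 _)) //.
  by rewrite subr_ge0 ler_pdivrMr ?cone_denom_gt0 // mul1r le_max lexx orbT.
under eq_bigr do rewrite mxE.
rewrite big_split /= -!mulr_suml simplex_tail //.
rewrite (bigD1 ord0) //= big1 => [|j /negbTE -> //].
by rewrite addr0 mul1r addrC subrK.
Qed.

Definition cone_base k (u : set_type (std_simplex R k.+1)) : set_type (std_simplex R k) :=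
  exist (fun x => x \in std_simplex R k) _ (cone_base_simplex u).

Lemma coord_comp_continuous (X : topologicalType) n (u : X -> 'rV[R]_n) j :
  continuous u -> continuous (fun x => u x ord0 j).
Proof. by move=> cu; exact: (continuous_compose cu (@coord_continuous _ _ _ ord0 j)). Qed.

Lemma cone_base_row_continuous (X : topologicalType) k (u : X -> 'rV[R]_k.+2) :
  continuous u -> continuous (fun x => cone_base_row (u x)).
Proof.
move=> cu; have ci i := @coord_comp_continuous _ _ _ i cu.
have c0 : continuous (fun x => 1 - u x ord0 ord0).
  by move=> x; apply: cvgB; [exact: cvg_cst|exact: ci].
have cd : continuous (fun x => (cone_denom (u x))^-1).
  move=> x; apply: cvgV; first exact/lt0r_neq0/cone_denom_gt0.
  apply: (@continuous_max R _ (fun=> 2^-1) (fun x => 1 - u x ord0 ord0)).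
    exact: cvg_cst.
  exact: c0.
apply: row_continuous => j; under eq_fun do rewrite mxE.
move=> x; apply: cvgD; first by apply: cvgM; [exact: ci|exact: cd].
apply: cvgM; first exact: cvg_cst.
apply: cvgB; first exact: cvg_cst.
by apply: cvgM; [exact: c0|exact: cd].
Qed.

Lemma simplex_val_continuous k :
  continuous (set_val : set_type (std_simplex R k) -> 'rV[R]_k.+1).
Proof. exact: initial_continuous. Qed.

Lemma cone_base_continuous k : continuous (@cone_base k).
Proof.
apply: continuous_comp_initial.
exact: (cone_base_row_continuous (@simplex_val_continuous k.+1)).
Qed.

Lemma lift_lift_ord0 k (i : 'I_k.+2) (j : 'I_k.+1) :
  lift ord0 (lift i j) = lift (lift ord0 i) (lift ord0 j).
Proof. by apply: val_inj; rewrite /= /bump /= !add1n ltnS addnS. Qed.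

Lemma insert0_lift_ord0 k (i : 'I_k.+2) (x : 'rV[R]_k.+2) :
  insert0 (lift ord0 i) x ord0 ord0 = x ord0 ord0.
Proof.
have -> : ord0 = lift (lift ord0 i) ord0 :> 'I_k.+3 by exact: val_inj.
by rewrite mxE liftK.
Qed.

Section chains.
Variables (X Y : topologicalType) (G : X * R -> Y) (G_cont : continuous G).

Section cone_simplex.
Variables (k : nat) (s : sing_simplex R X k).

(** The coordinate [u_0] is the time of the homotopy [G]: the face opposite to
    vertex 0 carries [G (_, 0)] and the apex the end value. *)
Definition cone_simplex (u : set_type (std_simplex R k.+1)) : Y :=
  G (s (cone_base u), val u ord0 ord0).

Lemma cone_simplex_continuous : continuous cone_simplex.
Proof.
apply: continuous_compose G_cont; apply: continuous_pair.
  apply: continuous_compose; [exact: cone_base_continuous|exact: cts_fun].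
exact: (@coord_comp_continuous _ _ _ _ (@simplex_val_continuous k.+1)).
Qed.

HB.instance Definition _ :=
  isContinuous.Build _ _ cone_simplex cone_simplex_continuous.
End cone_simplex.

Definition cone_chain k (c : chain R X k) : chain R Y k.+1 :=
  fglift (fun s : sing_simplex R X k =>
    (<< (cone_simplex s : sing_simplex R Y k.+1) >> : chain R Y k.+1)) c.

HB.instance Definition _ k := GRing.isZmodMorphism.Build
  (chain R X k) (chain R Y k.+1) (@cone_chain k) (lift_is_additive _).

Variables (y : Y) (G_end : forall x t, 2^-1 <= t -> G (x, t) = y).
Variables (f : continuousType X Y) (G_start : forall x, G (x, 0) = f x).

Lemma cone_simplex_base k (s : sing_simplex R X k) :
  (cone_simplex s \o face ord0 : sing_simplex R Y k) = (f \o s).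
Proof.
apply/continuousEP => v /=; rewrite /cone_simplex.
have v0 : insert0 ord0 (val v) ord0 ord0 = 0 by rewrite mxE unlift_none.
rewrite v0 G_start; congr (f (s _)).
apply/val_inj/rowP => j; rewrite mxE /= /cone_denom v0 subr0.
rewrite max_r ?invf_le1 ?ler1n ?ltr0n // !divr1 subrr mulr0 addr0 mxE.
by rewrite liftK.
Qed.

(** Positive dimension of [s] matters here: the cone over a point has the apex as
    its second face. *)
Lemma cone_simplex_face k (s : sing_simplex R X k.+1) (i : 'I_k.+2) :
  (cone_simplex s \o face (lift ord0 i) : sing_simplex R Y k.+1)
  = cone_simplex (s \o face i : sing_simplex R X k).
Proof.
apply/continuousEP => v /=; rewrite /cone_simplex /=.
have v0 := insert0_lift_ord0 i (val v).
rewrite v0; have [le_v|lt_v] := leP 2^-1 (val v ord0 ord0); first by rewrite !G_end.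
congr (G (s _, _)); apply/val_inj/rowP => j.
have lt_v' : 2^-1 < 1 - val v ord0 ord0 by lra.
have d_eq : cone_denom (val v) = 1 - val v ord0 ord0 by rewrite /cone_denom max_r // ltW.
have d_neq0 : 1 - val v ord0 ord0 != 0 by rewrite -d_eq lt0r_neq0 // cone_denom_gt0.
have -> : val (cone_base (face (lift ord0 i) v)) ord0 j =
    insert0 (lift ord0 i) (val v) ord0 (lift ord0 j) / (1 - val v ord0 ord0).
  by rewrite mxE /cone_denom v0 -/(cone_denom (val v)) d_eq divff // subrr mulr0 addr0.
case: (unliftP i j) => [j' ->|->]; rewrite !mxE ?lift_lift_ord0.
  by rewrite !liftK /= mxE d_eq divff // subrr mulr0 addr0.
by rewrite !unlift_none /= mul0r.
Qed.

Lemma boundary_cone_chain k (c : chain R X k.+1) :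
  boundary (cone_chain c) = pushforward f c - cone_chain (boundary c).
Proof.
rewrite -[RHS]/((@pushforward R X Y f k.+1 \- (@cone_chain k \o @boundary R X k)) c).
apply: (chain_additive_ext (phi := @boundary R Y k.+1 \o @cone_chain k.+1)) => s /=.
rewrite /cone_chain /boundary /pushforward !liftU !scale1r liftU scale1r.
rewrite big_ord_recl expr0 scale1r cone_simplex_base; congr (_ + _).
rewrite -/(@cone_chain k _) raddf_sum -sumrN; apply: eq_bigr => i _.
rewrite raddf_int_scalable /= /cone_chain liftU scale1r cone_simplex_face.
by rewrite exprS mulN1r scaleNr.
Qed.

End chains.

End cone.

(** * The degree of a null-homotopic map *)

Section degree.
Variable R : realType.

(** Standard simplices are nonempty, so no singular simplex has its image in the
    empty set; thus relative cycles of [(X, set0)] are cycles. *)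
Lemma chain_in_set0 (X : topologicalType) k (c : chain R X k) :
  chain_in set0 c -> c = 0.
Proof.
move=> c0; apply/eqP/freeg_eqP => s; rewrite coeff0; apply/eqP.
apply: contraT => /c0 s0; pose e : 'rV[R]_k.+1 := delta_mx ord0 ord0.
have e_simplex : e \in std_simplex R k.
  apply/mem_set; split => [j|]; first by rewrite mxE ler0n.
  rewrite (bigD1 ord0) //= big1 => [|j /negbTE j0]; last by rewrite mxE j0 andbF.
  by rewrite mxE !eqxx addr0.
by have := s0 _ (imageT s (exist (fun x => x \in std_simplex R k) e e_simplex)).
Qed.

Lemma chain_inZ (X : topologicalType) k (V : set X) (d : int) (c : chain R X k) :
  chain_in V c -> chain_in V (d *: c).
Proof.
move=> cV s; rewrite coeffZ => dc; apply: cV.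
by apply: contra_neq dc => ->; rewrite mulr0.
Qed.

Lemma chain_in0 (X : topologicalType) k (V : set X) : chain_in V (0 : chain R X k).
Proof. by move=> s; rewrite coeff0 eqxx. Qed.

(** The coefficient of the zero class is unique, and [0] is one. *)
Lemma local_generator_torsion_free (X : topologicalType) k (x : X)
    (c : chain R X k) (d : int) :
  local_generator x c -> rel_homologous [set~ x] 0 (d *: c) -> d = 0.
Proof.
move=> [_ gen] dc0; have cyc0 : rel_cycle [set~ x] (0 : chain R X k).
  by case: {c d gen dc0} k => [|k] //=; rewrite raddf0; exact: chain_in0.
have [d' [_ uniq_d']] := gen 0 cyc0.
rewrite -(uniq_d' d dc0); apply: uniq_d'; exists 0.
by rewrite scale0r subrr sub0r !raddf0; exact: chain_in0.
Qed.

(** The cone over a fundamental cycle of [X] bounds its image, so [d] times a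
    fundamental cycle of [Y] bounds as well; this is tested at the point [y0]. *)
Lemma degree_null_homotopic (X Y : topologicalType) k (k_gt0 : (0 < k)%N)
    (oX : X -> chain R X k) (oY : Y -> chain R Y k) (f : continuousType X Y)
    (d : int) (y0 : Y) :
  orientation oY -> null_homotopic_in R setT f -> has_degree oX oY f d -> d = 0.
Proof.
case: k k_gt0 oX oY => // k _ oX oY [genY _] [H [y [cH _ _ H0 H1]]].
move=> [cX [cY [[cX_cycle _] [_ cY_fund] [e0 fcX_dcY]]]].
(* Double speed makes [G] constant from time 1/2 on, as the cones require. *)
pose G (z : X * R) := H (z.1, 2 * z.2 + 0).
have cG : continuous G.
  exact: (reparam_continuous (@affine_time_continuous R 2 0) cH).
have G_end x t : 2^-1 <= t -> G (x, t) = y.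
  by move=> t_ge; rewrite /G /=; apply: H1; lra.
have G_start x : G (x, 0) = f x by rewrite /G /= mulr0 addr0 H0.
have := boundary_cone_chain cG G_end G_start cX.
rewrite (chain_in_set0 cX_cycle) raddf0 subr0 => cone_cX.
have dcY : boundary (cone_chain cG cX - e0) = d *: cY.
  move/chain_in_set0/eqP: fcX_dcY; rewrite subr_eq0 raddfB /= cone_cX => /eqP <-.
  by rewrite subKr.
apply: (local_generator_torsion_free (genY y0)).
have [e1 cY_oY] := cY_fund y0.
exists (d *: e1 - (cone_chain cG cX - e0)).
rewrite [boundary _]raddfB /= dcY [boundary _]raddf_int_scalable /= sub0r opprB addrA [- _ + _]addrC.
by rewrite -!scalerBr; exact: chain_inZ.
Qed.

End degree.

(** * Directions in the unit sphere *)

Section sphere.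
Variables (R : realType) (n : nat).

Definition normalize (v : 'rV[R]_n) : 'rV[R]_n := (enorm v)^-1 *: v.

Lemma normalize_sphere (v : 'rV[R]_n) : v != 0 -> normalize v \in sphere R n.
Proof.
move=> /enorm_neq0 v0; apply/mem_set; rewrite /sphere /= /normalize {1}/enorm.
under eq_bigr do rewrite mxE exprMn.
rewrite -mulr_sumr sqrtrM ?sqr_ge0// sqrtr_sqr -/(enorm v) ger0_norm ?mulVf//.
by rewrite invr_ge0 sqrtr_ge0.
Qed.

(** Used with [f] the link map and [d] the difference map. *)
Lemma null_homotopic_normalize (X : topologicalType) (d : X -> 'rV[R]_n)
    (f : X -> set_type (sphere R n)) :
  (forall x, val (f x) = normalize (d x)) ->
  null_homotopic_in R (@punctured R n) d -> null_homotopic_in R setT f.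
Proof.
move=> fd [H [y [cH H_neq0 y_neq0 H0 H1]]].
pose G z : set_type (sphere R n) :=
  exist (fun v => v \in sphere R n) _ (normalize_sphere (H_neq0 z)).
exists G, (exist (fun v => v \in sphere R n) _ (normalize_sphere y_neq0)).
split => // [|x|x t t1].
- apply: continuous_comp_initial => z; rewrite /continuous_at.
  apply: cvgZ; last exact: cH.
  apply: cvgV; first exact/enorm_neq0/H_neq0.
  by apply: continuous_comp; [exact: cH|exact: enorm_continuous].
- by apply: val_inj; rewrite fd /= H0.
- by apply: val_inj; rewrite /= H1.
Qed.

End sphere.

(** * Linked sets are not separated *)

Theorem theorem5p1 (R : realType) (mu : R -> R)
    (mu_cont : continuous mu)
    (mu_homotopic : forall k : nat, (0 < k)%N ->
       exists F : 'rV[R]_k -> 'rV[R]_k,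
         topological_embedding F /\
         group_homotopic R (map_mx mu : 'rV[R]_k -> 'rV[R]_k) F)
    (n m : nat) (m_gt0 : (1 <= m)%N) (m_lt_n : (m < n)%N)
    (A B : set 'rV[R]_n) (AB_disj : A `&` B = set0)
    (AB_link : link_pair_nonzero_degree AB_disj)
    (N : network R n m) (width_le : (width N <= n)%N) :
  net mu N @` A `&` net mu N @` B !=set0.
Proof.
apply: contrapT => no_meet.
have cA : continuous (fun xy : set_type A * set_type B => val xy.1 : 'rV[R]_n).
  move=> xy; apply: continuous_comp; first exact: cvg_fst.
  exact: initial_continuous.
have cB : continuous (fun xy : set_type A * set_type B => val xy.2 : 'rV[R]_n).
  move=> xy; apply: continuous_comp; first exact: cvg_snd.
  exact: initial_continuous.
have link_null : null_homotopic_in R setT (link_map AB_disj).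
  apply: null_homotopic_normalize => [//|].
  apply: (null_homotopic_of_net mu_cont mu_homotopic m_lt_n width_le cA cB) => -[a b].
  apply/eqP => eq_net; apply: no_meet; exists (net mu N (val a)); split.
    by exists (val a) => //; exact: set_mem (valP a).
  by exists (val b) => //; exact: set_mem (valP b).
case: AB_link => _ [p [q [pq_n _ _ _ [oAB [oS [deg [_ oS_or /eqP deg_neq0 deg_link]]]]]]].
have pq_gt0 : (0 < p + q)%N by rewrite -ltnS pq_n (leq_ltn_trans m_gt0).
have one_neq0 : const_mx 1 != 0 :> 'rV[R]_n.
  have i : 'I_n by exact: (Ordinal (ltn_trans m_gt0 m_lt_n)).
  by apply/eqP => /rowP/(_ i)/eqP; rewrite !mxE oner_eq0.
pose y0 : set_type (sphere R n) :=
  exist (fun v => v \in sphere R n) _ (normalize_sphere one_neq0).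
exact: deg_neq0 (degree_null_homotopic pq_gt0 y0 oS_or link_null deg_link).
Qed.
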